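(* Let $R$ be a finite ring. There exists a subcategory $\mathrm{OVIC}(R)$ of $\mathrm{VIC}(R)$ with the following properties: (a) the objects of $\mathrm{OVIC}(R)$ are the same as those of $\mathrm{VIC}(R)$, namely $[R^n]$ for $n\ge 0$; (b) every $\mathrm{VIC}(R)$-morphism $f\colon[R^d]\to[R^n]$ can be factored as $f=f_2\circ f_1$ with $f_1\colon[R^d]\to[R^d]$ a $\mathrm{VIC}(R)$-morphism and $f_2\colon[R^d]\to[R^n]$ an $\mathrm{OVIC}(R)$-morphism; (c) for every left Noetherian ring $\Bbbk$, the category of $\mathrm{OVIC}(R)$-modules over $\Bbbk$ is locally Noetherian.
   Context: Modules $R^n$ are column vectors regarded as right $R$-modules; $[R^n]$ denotes $R^n$ regarded as an object. The category $\mathrm{VIC}(R)$ has objects $[R^n]$, $n\ge0$; a morphism $[R^n]\to[R^m]$ is a pair $(f',f'')$ with $f'\colon R^n\to R^m$ injective $R$-linear and $f''\colon R^m\to R^n$ $R$-linear with $f''\circ f'=\mathrm{id}$; composition is $(g',g'')\circ(f',f'')=(g'\circ f', f''\circ g'')$. For a category $\mathcal C$, a $\mathcal C$-module over $\Bbbk$ is a functor from $\mathcal C$ to $\Bbbk$-modules; it is finitely generated if there exist finitely many objects $c_i$ and $x_i\in M(c_i)$ such that the smallest submodule containing all $x_i$ is $M$; the category of $\mathcal C$-modules over $\Bbbk$ is locally Noetherian if every submodule of a finitely generated $\mathcal C$-module over $\Bbbk$ is finitely generated. *)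

(* Defs.v *)
From HB Require Import structures.
From mathcomp Require Import all_boot all_order all_algebra.
From Stdlib Require List.
Set Implicit Arguments. Unset Strict Implicit. Unset Printing Implicit Defensive.
Import GRing.Theory.
Local Open Scope ring_scope.

(* R^n = column vectors 'cV[R]_n (right R-modules).  An R-linear map
   R^n -> R^m of right R-modules is left multiplication by an m x n matrix. *)

Record VICHom (R : pzRingType) (n m : nat) := VICHom_mk {
  vic_in  : 'M[R]_(m, n);
  vic_out : 'M[R]_(n, m);
  vic_inj : injective (fun v : 'cV[R]_n => vic_in *m v);
  vic_ret : vic_out *m vic_in = 1%:M }.

Lemma vic_id_inj (R : pzRingType) n : injective (fun v : 'cV[R]_n => 1%:M *m v).
Proof. by move=> u v /=; rewrite !mul1mx. Qed.

Definition vic_id (R : pzRingType) n : VICHom R n n :=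
  VICHom_mk (@vic_id_inj R n) (mulmx1 1%:M).

Section Comp.
Variables (R : pzRingType) (n m l : nat) (g : VICHom R m l) (f : VICHom R n m).
Lemma vic_comp_inj :
  injective (fun v : 'cV[R]_n => (vic_in g *m vic_in f) *m v).
Proof. by move=> u v /= /eqP; rewrite -!mulmxA => /eqP /vic_inj /vic_inj. Qed.
Lemma vic_comp_ret :
  (vic_out f *m vic_out g) *m (vic_in g *m vic_in f) = 1%:M.
Proof. by rewrite mulmxA -(mulmxA (vic_out f)) vic_ret mulmx1 vic_ret. Qed.
Definition vic_comp : VICHom R n l := VICHom_mk vic_comp_inj vic_comp_ret.
End Comp.

(** A subcategory of VIC(R) having the same objects [R^n], n >= 0, as VIC(R):
    a class of morphisms containing the identities and closed under
    composition. *)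
Record VICSubcat (R : pzRingType) := {
  sc_mem : forall n m, pred (VICHom R n m);
  sc_id : forall n, sc_mem (vic_id R n);
  sc_comp : forall n m l (g : VICHom R m l) (f : VICHom R n m),
      sc_mem g -> sc_mem f -> sc_mem (vic_comp g f) }.

Record SubcatMod (R : pzRingType) (S : VICSubcat R) (k : pzRingType) := {
  mobj : nat -> lmodType k;
  mact : forall n m (f : VICHom R n m), sc_mem S f -> mobj n -> mobj m;
  mact_add : forall n m f (pf : sc_mem S f) (x y : mobj n),
      @mact n m f pf (x + y) = mact pf x + mact pf y;
  mact_scale : forall n m f (pf : sc_mem S f) (a : k) (x : mobj n),
      @mact n m f pf (a *: x) = a *: mact pf x;
  mact_id : forall n (p : sc_mem S (vic_id R n)) (x : mobj n), mact p x = x;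
  mact_comp : forall n m l (g : VICHom R m l) (f : VICHom R n m)
      (pg : sc_mem S g) (pf : sc_mem S f) (pgf : sc_mem S (vic_comp g f))
      (x : mobj n), mact pgf x = mact pg (mact pf x) }.

Section Submodules.
Variables (R : pzRingType) (S : VICSubcat R) (k : pzRingType)
          (M : SubcatMod S k).

Definition is_submodule (N : forall n, mobj M n -> Prop) : Prop :=
  (forall n, N n 0) /\
  (forall n x y, N n x -> N n y -> N n (x + y)) /\
  (forall n (a : k) x, N n x -> N n (a *: x)) /\
  (forall n m (f : VICHom R n m) (pf : sc_mem S f) x,
      N n x -> N m (mact pf x)).

Definition in_generated (gens : seq {n : nat & mobj M n}) n (x : mobj M n) :=
  forall N, is_submodule N ->
    List.Forall (fun g => N (projT1 g) (projT2 g)) gens -> N n x.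

Definition fg_module : Prop :=
  exists gens : seq {n : nat & mobj M n}, forall n x, @in_generated gens n x.

Definition fg_submodule (N : forall n, mobj M n -> Prop) : Prop :=
  exists gens : seq {n : nat & mobj M n},
    List.Forall (fun g => N (projT1 g) (projT2 g)) gens /\
    forall n x, N n x <-> @in_generated gens n x.
End Submodules.

Definition locally_noetherian (R : pzRingType) (S : VICSubcat R)
    (k : pzRingType) : Prop :=
  forall M : SubcatMod S k, fg_module M ->
    forall N, @is_submodule R S k M N -> @fg_submodule R S k M N.

Definition left_ideal (k : pzRingType) (I : k -> Prop) : Prop :=
  I 0 /\ (forall x y, I x -> I y -> I (x + y)) /\
  (forall r x, I x -> I (r * x)).

Definition left_noetherian (k : pzRingType) : Prop :=
  forall I : k -> Prop, left_ideal I ->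
    exists s : seq k, forall x, I x <->
      exists c : 'I_(size s) -> k, x = \sum_(i < size s) c i * s`_i.

(* Main.v *)
Require Import Defs.
From mathcomp Require Import all_boot all_order all_algebra.
From mathcomp Require Import boolp.
Set Implicit Arguments. Unset Strict Implicit. Unset Printing Implicit Defensive.

(* VIC(R) itself is locally Noetherian, so it serves as OVIC(R), and then the
   factorization (b) is trivial.

   A morphism (A, B) : [R^d] -> [R^n] with BA = 1 is a word of length n in the
   finite alphabet of pairs (row of A, column of B).  Suppose (A', B') arises
   from (A, B) by inserting letters in such a way that
   - every inserted column of B' already occurs earlier in B,
   - for every vector v, the sum of the rows of A at the positions where the
     column of B is v is the same for both words.
   Then (A', B') = h (A, B), where h = (C, D) has for D the matrix of a
   surjection of positions and C = A'B + P(1 - AB), P being the inclusion of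
   the old positions: the second condition gives DA' = A, hence DC = 1.
   Moreover h is increasing below (A, B) for the order comparing first the
   B's, then the A's, lexicographically.  Both conditions follow from an
   embedding of words over a larger finite alphabet, so Higman's lemma makes
   divisibility a well-quasi-order, and a Groebner basis argument applies. *)

(** * Ascending subsequences for a transitive relation *)

Lemma infinitely_often_subsequence (P : nat -> Prop) :
  (forall N, exists2 j, N <= j & P j) ->
  exists2 s : nat -> nat, {homo s : i j / i < j} & forall i, P (s i).
Proof.
move=> inf_P.
have /choice[F FP] N : exists j, N <= j /\ P j by have [j] := inf_P N; exists j.
pose s := fix s i := if i is i'.+1 then F (s i').+1 else F 0.
exists s; last by case=> [|i]; apply: (FP _).2.
by apply: homo_ltn ltn_trans _ => i; apply: (FP _).1.
Qed.

Definition ascending T (r : T -> T -> Prop) (f : nat -> T) :=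
  exists2 s : nat -> nat, {homo s : i j / i < j} &
    forall i j, i < j -> r (f (s i)) (f (s j)).

(** Infinitely many [terminal] indices would form a subsequence without a good pair. Past the last
    one, each term has a later term above it, and iterating this choice gives the chain. *)
Lemma good_pairs_ascending T (r : T -> T -> Prop) :
    (forall y x z, r x y -> r y z -> r x z) ->
    (forall f : nat -> T, exists i j, i < j /\ r (f i) (f j)) ->
  forall f, ascending r f.
Proof.
move=> r_trans good f; pose terminal i := forall j, i < j -> ~ r (f i) (f j).
have [inf_term|] := pselect (forall N, exists2 j, N <= j & terminal j).
  have [s s_incr s_term] := infinitely_often_subsequence inf_term.
  have [i [j [ltij rij]]] := good (f \o s).
  by case: (s_term i (s j) (s_incr _ _ ltij)).
move=> /existsNP[N fin_term].
have /choice[G GP] j : exists j', N <= j -> j < j' /\ r (f j) (f j').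
  have [leNj|_] := boolP (N <= j); last by exists 0.
  have [|j' /not_implyP[ltj /contrapT rj]] := (@existsNP _ _).2 (_ : ~ terminal j).
    by move=> term_j; apply: fin_term; exists j.
  by exists j'.
have s_ge i : N <= iter i G N.
  by elim: i => //= i leN; apply: leq_trans leN (ltnW (GP _ leN).1).
exists (fun i => iter i G N).
  by apply: homo_ltn ltn_trans _ => i; apply: (GP _ (s_ge i)).1.
by apply: (homo_ltn (f := fun i => f (iter i G N)) r_trans) => i;
  apply: (GP _ (s_ge i)).2.
Qed.

Lemma ascending_comp T (r : T -> T -> Prop) (f : nat -> T) (s : nat -> nat) :
  {homo s : i j / i < j} -> ascending r (f \o s) -> ascending r f.
Proof.
by move=> s_incr [t t_incr asc]; exists (s \o t) => // i j /t_incr /s_incr.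
Qed.

(** * Higman's lemma over a finite alphabet *)

Section Higman.
Variable T : finType.
Implicit Types (f : nat -> seq T) (A : {set T}).

Let emb (u v : seq T) : Prop := subseq u v.

(* A word avoiding [c :: v] either avoids [c] or is [u ++ c :: w] with [c]
   not in [u] and [w] avoiding [v]: this allows an induction on the alphabet
   and on the avoided word. *)
Lemma higman_avoid A v :
    (forall c f, c \in A -> (forall i, {subset f i <= A :\ c}) ->
       ascending emb f) ->
    {subset v <= A} ->
  forall f, (forall i, {subset f i <= A}) ->
    (forall i, ~~ subseq v (f i)) -> ascending emb f.
Proof.
move=> IH; elim: v => [|c v IHv] vA f fA avoid; first by case/negP: (avoid 0);
  rewrite sub0seq.
have Ac : c \in A by apply: vA; rewrite mem_head.
have {}vA : {subset v <= A} by move=> x vx; apply: vA; rewrite inE vx orbT.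
have [inf_c|] := pselect (forall N, exists2 j, N <= j & c \notin f j).
  have [s s_incr s_c] := infinitely_often_subsequence inf_c.
  apply: ascending_comp s_incr _; apply: (IH c) => // i x fx.
  by rewrite in_setD1 (fA _ _ fx) andbT; apply: contraNneq (s_c i) => <-.
move=> /existsNP[N fin_c].
have {}fin_c i : c \in f (N + i).
  by apply/negPn/negP => notc; apply: fin_c; exists (N + i); rewrite ?leq_addr.
apply: (@ascending_comp _ _ _ (addn N)) => [i j|]; first by rewrite ltn_add2l.
pose u i := take (index c (f (N + i))) (f (N + i)).
pose w i := drop (index c (f (N + i))).+1 (f (N + i)).
have f_uw i : f (N + i) = u i ++ c :: w i.
  rewrite -[LHS](cat_take_drop (index c (f (N + i)))); congr (_ ++ _).
  by rewrite (drop_nth c) ?index_mem // nth_index.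
have u_c i : c \notin u i.
  by apply/negP => /index_ltn; rewrite ltnn.
have [] := IH c u Ac.
  move=> i x ux; rewrite in_setD1 (fA (N + i)) ?f_uw ?mem_cat ?ux // andbT.
  by apply: contraNneq (u_c i) => <-.
move=> s s_incr u_asc; apply: ascending_comp s_incr _.
have [||t t_incr w_asc] := IHv vA (w \o s).
- by move=> i x wx; apply: (fA (N + s i)); rewrite f_uw mem_cat inE wx !orbT.
- move=> i; apply: contra (avoid (N + s i)) => vw; rewrite f_uw.
  by apply: subseq_trans (suffix_subseq _ _); rewrite /= eqxx.
exists t => // i j ltij; rewrite /emb /= !f_uw; apply: cat_subseq;
  first exact/u_asc/t_incr.
by rewrite /= eqxx; apply: w_asc.
Qed.

(** Induction on the size of the alphabet. Either some later word contains the first one, which is a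
    good pair, or all later words avoid it and [higman_avoid] applies. *)
Theorem higman f : ascending emb f.
Proof.
suff higmanA n A : #|A| <= n -> forall f, (forall i, {subset f i <= A}) -> ascending emb f.
  by apply: (higmanA #|[set: T]| [set: T]) => // i x; rewrite inE.
elim: n A => [|n IHn] A leAn {}f fA.
  exists id => // i j _; rewrite /emb; case fi: (f i) => [|x s]; first exact: sub0seq.
  have := fA i x; rewrite fi mem_head => /(_ isT).
  by move: leAn; rewrite leqn0 cards_eq0 => /eqP->; rewrite inE.
pose r (u v : {w : seq T | {subset w <= A}}) := emb (sval u) (sval v).
have [||s s_incr asc] := @good_pairs_ascending _ r _ _ (fun i => exist _ (f i) (fA i)).
- by move=> y x z; apply: subseq_trans.
- move=> {f fA} g; have [[j gj]|no] := pselect (exists j, r (g 0) (g j.+1)).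
    by exists 0, j.+1.
  have [|||i|s s_incr asc] := @higman_avoid A (sval (g 0)) _ _ (fun j => sval (g j.+1)).
  + move=> c f Ac; apply: IHn; rewrite -ltnS; apply: leq_trans leAn.
    by rewrite [in leqRHS](cardsD1 c) Ac.
  + exact: (svalP (g 0)).
  + by move=> i; apply: (svalP (g i.+1)).
  + by apply/negP => gi; apply: no; exists i.
  by exists (s 0).+1, (s 1).+1; split; [rewrite ltnS s_incr | apply: asc].
by exists s.
Qed.
End Higman.

Import Order.TTheory GRing.Theory.
Local Open Scope ring_scope.

(** * Ranks in a finite type ordered through a code *)

Section Rank.
Variables (disp : Order.disp_t) (O : orderType disp) (F : finType) (code : F -> O).

Definition rank (u : F) := #|[pred v | (code v < code u)%O]|.

Lemma ltn_rank u v : (rank u < rank v)%N = (code u < code v)%O.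
Proof.
have le_rank x y : (code x <= code y)%O -> (rank x <= rank y)%N.
  by move=> lexy; apply/subset_leq_card/subsetP => z; rewrite !inE => /lt_le_trans->.
case: ltP => [ltuv | /le_rank]; last by rewrite leqNgt => /negbTE.
apply/proper_card/properP; split; last by exists u; rewrite !inE ?ltxx.
by apply/subsetP => z; rewrite !inE => /lt_trans->.
Qed.

Lemma rank_inj : injective code -> injective rank.
Proof.
move=> code_inj u v eq_rk; apply: code_inj; apply/eqP; rewrite eq_le.
by rewrite !leNgt -!ltn_rank eq_rk ltnn.
Qed.
End Rank.

(** * Pairs of matrices as words, and insertion of letters *)

Section Words.
Variable R : finPzRingType.

(** Stored in the letters: equal values at [i] and [phi i] force every column met before [phi i] to
    occur in [B] before [i]. *)
Definition seen d n (B : 'M[R]_(d, n)) (i : nat) : {set 'cV[R]_d} :=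
  [set col l B | l : 'I_n & (l < i)%N].

Definition fiber_sum d n (A : 'M[R]_(n, d)) (B : 'M[R]_(d, n)) :
    {ffun 'cV[R]_d -> 'rV[R]_d} :=
  [ffun v => \sum_(l | col l B == v) row l A].

Definition col_code d n (B : 'M[R]_(d, n)) : n.-tuplelexi nat :=
  [tuple enum_rank (col i B) : nat | i < n].
Definition row_code d n (A : 'M[R]_(n, d)) : n.-tuplelexi nat :=
  [tuple enum_rank (row i A) : nat | i < n].

Lemma col_code_lt d n (B1 B2 : 'M[R]_(d, n)) :
  reflect (exists2 i : 'I_n, forall l : 'I_n, (l < i)%N -> col l B1 = col l B2
             & (enum_rank (col i B1) < enum_rank (col i B2))%N)
          (col_code B1 < col_code B2)%O.
Proof.
apply: (iffP ltxi_tuplePlt) => -[i eqB ltB]; exists i => [l /eqB|].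
- by rewrite !tnth_mktuple => /ord_inj/enum_rank_inj.
- by move: ltB; rewrite !tnth_mktuple.
- by rewrite !tnth_mktuple => ->.
- by rewrite !tnth_mktuple.
Qed.

Lemma row_code_lt d n (A1 A2 : 'M[R]_(n, d)) :
  reflect (exists2 i : 'I_n, forall l : 'I_n, (l < i)%N -> row l A1 = row l A2
             & (enum_rank (row i A1) < enum_rank (row i A2))%N)
          (row_code A1 < row_code A2)%O.
Proof.
apply: (iffP ltxi_tuplePlt) => -[i eqA ltA]; exists i => [l /eqA|].
- by rewrite !tnth_mktuple => /ord_inj/enum_rank_inj.
- by move: ltA; rewrite !tnth_mktuple.
- by rewrite !tnth_mktuple => ->.
- by rewrite !tnth_mktuple.
Qed.

Lemma col_code_inj d n : injective (@col_code d n).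
Proof.
move=> B1 B2 eqB; apply: trmx_inj; apply/row_matrixP => i; rewrite -!tr_col; congr _^T.
have /(congr1 (fun t => tnth t i)) := eqB.
by rewrite !tnth_mktuple => /ord_inj/enum_rank_inj.
Qed.

Lemma row_code_inj d n : injective (@row_code d n).
Proof.
move=> A1 A2 eqA; apply/row_matrixP => i; have /(congr1 (fun t => tnth t i)) := eqA.
by rewrite !tnth_mktuple => /ord_inj/enum_rank_inj.
Qed.

(** Columns go first: the row comparison in [insertion_factor] needs [B *m A1 = 1%:M], which follows
    once the second components agree. *)
Definition code d n (w : 'M[R]_(n, d) * 'M[R]_(d, n)) :
    (n.-tuplelexi nat *l n.-tuplelexi nat)%type :=
  (col_code w.2, row_code w.1).

Lemma code_inj d n : injective (@code d n).
Proof.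
move=> [A1 B1] [A2 B2] eq_code.
by have /= -> := col_code_inj (congr1 fst eq_code);
   have /= -> := row_code_inj (congr1 snd eq_code).
Qed.

Section Insertion.
Variables (d n m : nat) (A : 'M[R]_(n, d)) (B : 'M[R]_(d, n)).
Variables (A' : 'M[R]_(m, d)) (B' : 'M[R]_(d, m)) (phi : 'I_n -> 'I_m).
Hypothesis phi_incr : {homo phi : i j / (i < j)%N}.
Hypothesis rowA' : forall i, row (phi i) A' = row i A.
Hypothesis colB' : forall i, col (phi i) B' = col i B.
Hypothesis seenB' : forall i, seen B' (phi i) = seen B i.
Hypothesis seen_all : seen B' m = seen B n.
Hypothesis fiberB' : fiber_sum A' B' = fiber_sum A B.
Hypothesis BA1 : B *m A = 1%:M.

Let im := [set phi i | i : 'I_n].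

Lemma phi_inj : injective phi.
Proof.
move=> i j eqij; apply/val_inj/eqP; case: ltngtP => // /phi_incr;
by rewrite eqij ltnn.
Qed.

(** The old positions, those in the image of [phi], already account for the whole fiber sum over
    [v]. *)
Lemma sum_inserted v : \sum_(j | (col j B' == v) && (j \notin im)) row j A' = 0.
Proof.
have /ffunP/(_ v) := fiberB'; rewrite !ffunE (bigID (mem im)) /=.
suff -> : \sum_(j | (col j B' == v) && (j \in im)) row j A' =
          \sum_(i | col i B == v) row i A.
  by move/(canRL (addKr _)); rewrite addNr.
transitivity (\sum_(j in phi @: [set i | col i B == v]) row j A').
  apply: eq_bigl => j; apply/andP/imsetP => [[Bj /imsetP[i _ def_j]]|[i]].
    by exists i => //; rewrite inE -colB' -def_j.
  by rewrite inE -colB' => Bi ->; rewrite Bi imset_f.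
rewrite big_imset /=; last by move=> i j _ _; apply: phi_inj.
by apply: eq_big => i; rewrite ?inE ?rowA'.
Qed.

Definition first_occurrence (i : 'I_n) :=
  [forall l, (col l B == col i B) ==> (i <= l)%N].

(** [psi] inverts [phi] on old positions and sends an inserted one to the first occurrence of its
    column in [B], which exists by [seen_all]. For inserted [j] before [phi i], [seenB'] puts that
    occurrence before [i]. *)
Lemma exists_collapse : exists psi : 'I_m -> 'I_n,
  [/\ cancel phi psi, forall j, col (psi j) B = col j B',
      forall j, j \notin im -> first_occurrence (psi j)
    & forall i (j : 'I_m), (j < phi i)%N -> (psi j < i)%N].
Proof.
have /choice[psi psiP] j : exists i, if j \in im then phi i = j else
    col i B = col j B' /\ first_occurrence i.
  have [/imsetP[i _ ->]|_] := boolP (j \in im); first by exists i.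
  have: col j B' \in seen B n by rewrite -seen_all; apply/imsetP; exists j;
    rewrite ?inE ?ltn_ord.
  case/imsetP => i _ Bi.
  case: (@arg_minnP _ i (fun i => col i B == col j B') val); first by rewrite Bi.
  by move=> l /eqP Bl minl; exists l; split=> //; apply/forallP => l';
    apply/implyP; rewrite Bl; apply: minl.
exists psi.
have phiK : cancel phi psi.
  by move=> i; apply: phi_inj; have := psiP (phi i); rewrite imset_f.
have colpsi j : col (psi j) B = col j B'.
  by have := psiP j; case: ifP => [_ phij|_ []//]; rewrite -colB' phij.
have firstpsi j : j \notin im -> first_occurrence (psi j).
  by move=> /negbTE imj; have := psiP j; rewrite imj => -[].
split=> // i j ltj; have [/imsetP[l _ def_j]|/firstpsi/forallP first_j] := boolP (j \in im).
  rewrite def_j in ltj *; rewrite phiK ltnNge; apply: contraL ltj; rewrite -leqNgt.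
  by rewrite leq_eqVlt => /orP[/eqP/val_inj->|/phi_incr/ltnW].
have: col j B' \in seen B i by rewrite -seenB'; apply/imsetP; exists j; rewrite ?inE.
case/imsetP=> l; rewrite inE => ltl Bl; apply: leq_ltn_trans ltl.
by apply: (implyP (first_j l)); rewrite colpsi Bl.
Qed.

(* Each inserted row of [C] is the row of [A'] read through [B], and each
   inserted column of [D] repeats an earlier one; the inserted contributions
   to [D *m A'] cancel because the fiber sums agree. *)
Lemma insertion_factor : exists (C : 'M[R]_(m, n)) (D : 'M[R]_(n, m)),
  [/\ D *m C = 1%:M, C *m A = A', B *m D = B'
    & forall (A1 : 'M[R]_(n, d)) (B1 : 'M[R]_(d, n)), B1 *m A1 = 1%:M ->
        (code (A1, B1) < code (A, B))%O ->
        (code (C *m A1, B1 *m D) < code (A', B'))%O].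
Proof.
have [psi [phiK colpsi firstpsi ltpsi]] := exists_collapse.
pose P : 'M[R]_(m, n) := \matrix_(j, i) (phi i == j)%:R.
pose D : 'M[R]_(n, m) := \matrix_(i, j) (psi j == i)%:R.
have colD (X : 'M[R]_(d, n)) j : col j (X *m D) = col (psi j) X.
  apply/colP => x; rewrite !mxE (bigD1 (psi j)) //= !mxE eqxx mulr1 big1 ?addr0 //.
  by move=> l; rewrite mxE eq_sym => /negbTE->; rewrite mulr0.
have DP : D *m P = 1%:M.
  apply/matrixP => i l;
    rewrite !mxE (bigD1 (phi l)) //= !mxE eqxx phiK mulr1 big1 ?addr0 1?eq_sym //.
  by move=> j; rewrite !mxE eq_sym => /negbTE->; rewrite mulr0.
have rowP_im (X : 'M[R]_(n, d)) i : row (phi i) (P *m X) = row i X.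
  apply/rowP => x; rewrite !mxE (bigD1 i) //= !mxE eqxx mul1r big1 ?addr0 //.
  by move=> l; rewrite mxE (inj_eq phi_inj) => /negbTE->; rewrite mul0r.
have rowP_notin (X : 'M[R]_(n, d)) j : j \notin im -> row j (P *m X) = 0.
  move=> imj; apply/rowP => x; rewrite !mxE big1 // => i _; rewrite mxE.
  by case: eqP => [def_j|]; rewrite ?mul0r //; rewrite -def_j imset_f in imj.
have DA' : D *m A' = A.
  apply/row_matrixP => i.
  have -> : row i (D *m A') = \sum_(j | psi j == i) row j A'.
    apply/rowP => x; rewrite !mxE summxE [RHS]big_mkcond /=; apply: eq_bigr => j _.
    by rewrite !mxE; case: eqP; rewrite ?mul1r ?mul0r.
  rewrite (bigID (mem im)) /= [X in _ + X](_ : _ = 0) ?addr0.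
    rewrite (big_pred1 (phi i)) ?rowA' // => j /=.
    apply/andP/eqP => [[/eqP <- /imsetP[l _ ->]]|->]; first by rewrite phiK.
    by rewrite phiK eqxx imset_f.
  (* If [i] is a first occurrence, the inserted positions over it are all those carrying its column,
     and [sum_inserted] applies; otherwise no inserted position lies over it. *)
  have [first_i|notfirst_i] := boolP (first_occurrence i).
    rewrite -[RHS](sum_inserted (col i B)); apply: eq_bigl => j.
    case imj: (j \in im); rewrite ?andbF //= !andbT -colpsi.
    apply/eqP/eqP => [->//|eqB].
    apply/val_inj/eqP; rewrite eqn_leq.
    have /forallP/(_ i) := firstpsi j (negbT imj); rewrite eqB eqxx /= => ->.
    by move/forallP: first_i => /(_ (psi j)); rewrite eqB eqxx /= => ->.
  rewrite big1 // => j /andP[/eqP psij /firstpsi].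
  by rewrite psij (negbTE notfirst_i).
pose C := A' *m B + P *m (1%:M - A *m B).
have CE (X : 'M[R]_(n, d)) : C *m X = A' *m (B *m X) + P *m (X - A *m (B *m X)).
  by rewrite mulmxDl -!mulmxA mulmxBl mul1mx -mulmxA.
exists C, D; split.
- by rewrite mulmxDr !mulmxA DP mul1mx DA' addrC subrK.
- by rewrite CE BA1 !mulmx1 subrr mulmx0 addr0.
- by apply: trmx_inj; apply/row_matrixP => j; rewrite -!tr_col colD colpsi.
move=> A1 B1 BA11; rewrite /code !ltxi_pair /=.
(* Positions before [phi i] collapse to positions before [i], so a first difference at [i] moves to
   [phi i]. *)
have lt_cols : (col_code B1 < col_code B)%O -> (col_code (B1 *m D) < col_code B')%O.
  case/col_code_lt => i eqB ltB; apply/col_code_lt; exists (phi i) => [j /ltpsi ltj|].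
    by rewrite colD eqB // colpsi.
  by rewrite colD phiK colB'.
case: (ltgtP (col_code B1) (col_code B)) => //= [/lt_cols/[dup]/ltW->|/col_code_inj eqB].
  by rewrite leNgt => ->.
have -> : B1 *m D = B'.
  by apply: trmx_inj; apply/row_matrixP => j; rewrite -!tr_col colD eqB colpsi.
(* Since [B1 = B], [C *m A1 = A' + P *m (A1 - A)]: inserted rows agree with those of [A'], and the
   first differing row moves from [i] to [phi i]. *)
rewrite lexx /= => /row_code_lt[i eqA ltA]; apply/row_code_lt;
  exists (phi i) => [j ltj|].
  rewrite CE -eqB BA11 !mulmx1 linearD /=;
    case: (boolP (j \in im)) => [/imsetP[l _ def_j]|/rowP_notin->].
    rewrite def_j rowP_im linearB /= eqA ?subrr ?addr0 //.
    by have := ltpsi i j ltj; rewrite def_j phiK.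
  by rewrite addr0.
by rewrite CE -eqB BA11 !mulmx1 linearD /= rowP_im linearB /= rowA' addrC subrK.
Qed.
End Insertion.
End Words.

(** The mask selecting the subsequence cuts [enum 'I_m] down to a strictly increasing list of [n]
    ordinals, whose entries are the values of [phi]. *)
Lemma subseq_map_enum (T : eqType) n m (F : 'I_n -> T) (G : 'I_m -> T) :
    subseq [seq F i | i <- enum 'I_n] [seq G j | j <- enum 'I_m] ->
  exists2 phi : 'I_n -> 'I_m, {homo phi : i j / (i < j)%N} &
    forall i, G (phi i) = F i.
Proof.
case/subseqP => b _; rewrite -map_mask; set t := mask b _ => eq_map.
have size_t : size t = n by rewrite -(size_map G) -eq_map size_map size_enum_ord.
have sorted_t : sorted ltn (map val t).
  apply: (subseq_sorted ltn_trans) (iota_ltn_sorted 0 m).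
  by rewrite -val_enum_ord; apply/map_subseq/mask_subseq.
exists (fun i => tnth (Tuple (introT eqP size_t)) i) => [i j ltij|i].
  have x0 := tnth (Tuple (introT eqP size_t)) i.
  rewrite !(tnth_nth x0) /= -!(nth_map x0 0%N val) ?size_t //.
  by apply: (sorted_ltn_nth ltn_trans 0%N sorted_t); rewrite ?inE ?size_map ?size_t.
rewrite (tnth_nth (tnth (Tuple (introT eqP size_t)) i)) /=.
rewrite -(nth_map _ (F i)) ?size_t // -eq_map (nth_map i) ?size_enum_ord //.
by rewrite nth_ord_enum.
Qed.

(** * Divisibility between morphisms out of a fixed [[R^d]] *)

Section VIC.
Variable R : finPzRingType.

Lemma VICHom_eq n m (f g : VICHom R n m) :
  vic_in f = vic_in g -> vic_out f = vic_out g -> f = g.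
Proof.
case: f g => [A B iA rA] [A' B' iA' rA'] /= eqA eqB.
by move: iA rA iA' rA'; rewrite eqA eqB => *; congr VICHom_mk; apply: Prop_irrelevance.
Qed.

Lemma VICHom_of_retraction n m (C : 'M[R]_(m, n)) (D : 'M[R]_(n, m)) :
  D *m C = 1%:M -> exists h : VICHom R n m, vic_in h = C /\ vic_out h = D.
Proof.
move=> DC1; have injC : injective (fun v : 'cV[R]_n => C *m v).
  by move=> u v /(congr1 (mulmx D)); rewrite !mulmxA DC1 !mul1mx.
by exists (VICHom_mk injC DC1).
Qed.

Definition vic_rank d n (f : VICHom R d n) :=
  rank (@code R d n) (vic_in f, vic_out f).

Lemma vic_rank_inj d n : injective (@vic_rank d n).
Proof. by move=> f g /(rank_inj (@code_inj _ _ _))[? ?]; apply: VICHom_eq. Qed.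

(** Divisibility of monomials. The second clause keeps lower terms low, so that [h] carries an
    element led by [u] to one led by [v]. *)
Definition divides d (u v : {n : nat & VICHom R d n}) : Prop :=
  exists2 h : VICHom R (tag u) (tag v), vic_comp h (tagged u) = tagged v &
    forall f : VICHom R d (tag u), (vic_rank f < vic_rank (tagged u))%N ->
      (vic_rank (vic_comp h f) < vic_rank (tagged v))%N.

(** With [d] fixed the alphabet is finite. The first letter holds the global data, and the tags
    [inl] and [inr] force an embedding to match first letters. *)
Definition vic_word d (u : {n : nat & VICHom R d n}) :=
  let A := vic_in (tagged u) in let B := vic_out (tagged u) in
  inl (seen B (tag u), fiber_sum A B) ::
    [seq inr (row l A, col l B, seen B l) | l <- enum 'I_(tag u)].

Lemma subseq_divides d (u v : {n : nat & VICHom R d n}) :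
  subseq (vic_word u) (vic_word v) -> divides u v.
Proof.
case: u v => [n f] [m f']; rewrite /vic_word /divides /=.
case: ifP => [/eqP[eq_seen eq_fiber]|_]; last first.
  by move/mem_subseq/(_ _ (mem_head _ _))/mapP => -[].
case/subseq_map_enum => phi phi_incr phiE.
have rowE i : row (phi i) (vic_in f') = row i (vic_in f) by case: (phiE i).
have colE i : col (phi i) (vic_out f') = col i (vic_out f) by case: (phiE i).
have seenE i : seen (vic_out f') (phi i) = seen (vic_out f) i by case: (phiE i).
have [C [D [DC1 CA BD lt_code]]] := insertion_factor phi_incr rowE colE seenE
  (esym eq_seen) (esym eq_fiber) (vic_ret f).
have [h [hC hD]] := VICHom_of_retraction DC1; exists h.
  by apply: VICHom_eq; rewrite /= ?hC ?hD.
move=> f1; rewrite /vic_rank !ltn_rank /= hC hD => ltf1.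
by apply: lt_code; rewrite ?vic_ret.
Qed.

Lemma vic_divides_ascending d (u : nat -> {n : nat & VICHom R d n}) :
  ascending (@divides d) u.
Proof.
have [s s_incr asc] := higman (fun i => vic_word (u i)).
by exists s => // i j ltij; apply/subseq_divides/asc.
Qed.

Definition vic_full : VICSubcat R :=
  @Build_VICSubcat R (fun _ _ => predT) (fun _ => isT) (fun _ _ _ _ _ _ _ => isT).
End VIC.

(** * Spans and left Noetherian rings *)

Section Span.
Variables (k : pzRingType) (V : lmodType k).

Inductive span (G : V -> Prop) : V -> Prop :=
| span0 : span G 0
| span_step c v w : G v -> span G w -> span G (c *: v + w).

Variable G : V -> Prop.

Lemma span_gen v : G v -> span G v.
Proof. by move=> Gv; rewrite -[v]scale1r -[_ *: _]addr0;
  apply: span_step (span0 _). Qed.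

Lemma spanD v w : span G v -> span G w -> span G (v + w).
Proof. by move=> + Gw; elim=> [|c x y Gx _ IH]; rewrite ?add0r // -addrA;
  apply: span_step. Qed.

Lemma spanZ c v : span G v -> span G (c *: v).
Proof.
elim=> [|a x y Gx _ IH]; first by rewrite scaler0; apply: span0.
by rewrite scalerDr scalerA; apply: span_step.
Qed.

Lemma spanN v : span G v -> span G (- v).
Proof. by rewrite -scaleN1r; apply: spanZ. Qed.

Lemma spanB v w : span G v -> span G w -> span G (v - w).
Proof. by move=> Gv Gw; apply/spanD/spanN. Qed.

Lemma span_sum I (r : seq I) (F : I -> V) :
  (forall i, span G (F i)) -> span G (\sum_(i <- r) F i).
Proof. by move=> GF; elim/big_ind: _ => //; [apply: span0 | apply: spanD]. Qed.
End Span.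

Lemma span_map (k : pzRingType) (V W : lmodType k) (G : V -> Prop) (H : W -> Prop)
    (f : V -> W) :
    {morph f : x y / x + y} -> (forall a, {morph f : x / a *: x}) ->
    (forall v, G v -> span H (f v)) ->
  forall v, span G v -> span H (f v).
Proof.
move=> fD fZ GH v; elim=> [|c x y /GH Hx _ IH].
  have -> : f 0 = 0 by rewrite -(scale0r 0) fZ scale0r.
  exact: span0.
by rewrite fD fZ; apply: spanD => //; apply: spanZ.
Qed.

(** The combinations of finitely many [c i] form a left ideal. Its finitely many generators involve
    only the [c i] with [i < K] for some [K], and [c K] lies in the ideal too. *)
Lemma left_noetherian_combination (k : pzRingType) (c : nat -> k) :
  left_noetherian k -> exists K (r : nat -> k), c K = \sum_(i < K) r i * c i.
Proof.
pose comb K x := exists r : nat -> k, x = \sum_(i < K) r i * c i.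
have comb_le K K' x : (K <= K')%N -> comb K x -> comb K' x.
  move=> leK [r ->]; exists (fun i => if (i < K)%N then r i else 0).
  rewrite (big_ord_widen _ (fun i => r i * c i) leK) big_mkcond /=.
  by apply: eq_bigr => i _; case: ifP; rewrite ?mul0r.
have combD K x y : comb K x -> comb K y -> comb K (x + y).
  move=> [r ->] [r' ->]; exists (fun i => r i + r' i).
  by rewrite -big_split; apply: eq_bigr => i _; rewrite mulrDl.
have combM K a x : comb K x -> comb K (a * x).
  move=> [r ->]; exists (fun i => a * r i).
  by rewrite big_distrr; apply: eq_bigr => i _; rewrite /= mulrA.
have comb0 K : comb K 0.
  by exists (fun=> 0); rewrite big1 // => i _; rewrite mul0r.
have combc K : comb K.+1 (c K).
  exists (fun i => (i == K)%:R); rewrite big_ord_recr /= eqxx mul1r big1 ?add0r //.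
  by move=> i _; rewrite ltn_eqF ?mul0r.
case/(_ (fun x => exists K, comb K x)) => [|s sP].
  split; first by exists 0%N.
  split=> [x y [K1 x1] [K2 y2]|a x [K Kx]]; last by exists K; apply: combM.
  by exists (maxn K1 K2); apply: combD;
    [apply: comb_le x1; apply: leq_maxl | apply: comb_le y2; apply: leq_maxr].
have /choice[K KP] (i : 'I_(size s)) : exists K, comb K s`_i.
  apply/sP; exists (fun j => (j == i)%:R).
  rewrite (bigD1 i) //= eqxx mul1r big1 ?addr0 // => j /negbTE->.
  by rewrite mul0r.
exists (\max_i K i)%N; have [a ->] : exists a : 'I_(size s) -> k,
    c (\max_i K i)%N = \sum_(i < size s) a i * s`_i.
  by apply/sP; exists (\max_i K i).+1.
apply: (big_ind (comb _)) => [|x y|i _]; [exact: comb0|exact: combD|].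
by apply: combM; apply: comb_le (KP i); apply: leq_bigmax.
Qed.

(** * The Groebner basis argument *)

Section Groebner.
Variables (R : finPzRingType) (k : pzRingType) (M : SubcatMod (vic_full R) k).
Implicit Types (L : seq {n : nat & mobj M n}) (N Q : forall n, mobj M n -> Prop).

Definition act n m (f : VICHom R n m) (x : mobj M n) : mobj M m :=
  @mact _ _ _ M n m f isT x.

Lemma actD n m (f : VICHom R n m) : {morph act f : x y / x + y}.
Proof. exact: mact_add. Qed.

Lemma actZ n m (f : VICHom R n m) a : {morph act f : x / a *: x}.
Proof. exact: mact_scale. Qed.

Lemma act_comp n m l (g : VICHom R m l) (f : VICHom R n m) x :
  act g (act f x) = act (vic_comp g f) x.
Proof. by rewrite /act -(mact_comp _ _ (isT : sc_mem (vic_full R) (vic_comp g f))). Qed.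

Lemma is_submodule_act N : (forall n, N n 0) ->
    (forall n x y, N n x -> N n y -> N n (x + y)) ->
    (forall n (a : k) x, N n x -> N n (a *: x)) ->
    (forall n m (f : VICHom R n m) x, N n x -> N m (act f x)) ->
  is_submodule N.
Proof.
move=> N0 ND NZ Nact; split=> //; split=> //; split=> // n m f pf x Nx.
by rewrite (bool_irrelevance pf isT); apply: Nact.
Qed.

Lemma in_generated_submodule L : is_submodule (in_generated L).
Proof.
split; first by move=> n N [].
split; first by move=> n x y Lx Ly N sN LN; apply: (sN.2.1); [apply: Lx | apply: Ly].
split; first by move=> n a x Lx N sN LN; apply: (sN.2.2.1); apply: Lx.
by move=> n m f pf x Lx N sN LN; apply: (sN.2.2.2); apply: Lx.
Qed.

Lemma in_generated_head n (x : mobj M n) L : in_generated (existT _ n x :: L) x.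
Proof. by move=> N sN LN; inversion LN. Qed.

Lemma in_generated_cons u L n (x : mobj M n) :
  in_generated L x -> in_generated (u :: L) x.
Proof. by move=> Lx N sN LN; apply: Lx => //; inversion LN. Qed.

Lemma submoduleB N n (x y : mobj M n) : is_submodule N ->
  N n x -> N n y -> N n (x - y).
Proof.
by move=> [_ [ND [NZ _]]] Nx Ny; apply: ND => //; rewrite -scaleN1r; apply: NZ.
Qed.

Lemma submodule_sum N n K (F : 'I_K -> mobj M n) : is_submodule N ->
  (forall i, N n (F i)) -> N n (\sum_i F i).
Proof. by move=> [N0 [ND _]] NF; apply: big_ind => //; apply: ND. Qed.

Section Step.
Variables (d : nat) (g : mobj M d) (Q : forall n, mobj M n -> Prop).
Hypothesis submod_Q : is_submodule Q.

(** The filtration by leading monomials: the translates [act f g] are the monomials, and [Q] counts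
    as zero. *)
Definition below n r : mobj M n -> Prop :=
  span (fun x => Q x \/ exists2 f : VICHom R d n, (vic_rank f < r)%N & x = act f g).

Lemma below_le n r r' (x : mobj M n) : (r <= r')%N -> below r x -> below r' x.
Proof.
move=> ler; apply: (span_map (f := id)) => // y [Qy|[f ltf ->]];
  apply: span_gen; first by left.
by right; exists f => //; apply: leq_trans ltf ler.
Qed.

Lemma below0 n (x : mobj M n) : below 0 x -> Q x.
Proof.
have [Q0 [QD [QZ _]]] := submod_Q.
by elim=> // c y z [Qy|[]] // _ Qz; apply: QD => //; apply: QZ.
Qed.

(** Since [vic_rank] is injective, there is at most one monomial of rank [r], and its occurrences
    merge into a single coefficient. *)
Lemma below_split n r (x : mobj M n) : below r.+1 x ->
  below r x \/ exists2 f : VICHom R d n, vic_rank f = r &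
    exists c, below r (x - c *: act f g).
Proof.
elim=> [|c y z Gy _ IH]; first by left; apply: span0.
have [|no] := pselect (below r y).
  move=> ry; have {ry} rcy : below r (c *: y) by apply: spanZ.
  case: IH => [rz|[f rf [a rz]]]; [left|right]; first exact: spanD.
  by exists f => //; exists a; rewrite -addrA; apply: spanD.
case: Gy => [Qy|[f ltf def_y]]; first by case: no; apply: span_gen; left.
have {ltf} rf : vic_rank f = r.
  move: ltf; rewrite ltnS leq_eqVlt => /orP[/eqP//|ltf].
  by case: no; apply: span_gen; right; exists f.
right; exists f => //; case: IH => [rz|[f' rf' [a rz]]].
  by exists c; rewrite def_y addrC addKr.
have eq_f : f' = f by apply: vic_rank_inj; rewrite rf rf'.
by exists (c + a); rewrite def_y -eq_f scalerDl opprD addrACA subrr add0r.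
Qed.

Lemma below_act n m (h : VICHom R n m) r r' (x : mobj M n) :
    (forall f : VICHom R d n, (vic_rank f < r)%N -> (vic_rank (vic_comp h f) < r')%N) ->
  below r x -> below r' (act h x).
Proof.
move=> lt_h; apply: span_map; [exact: actD | exact: actZ | move=> y Gy].
apply: span_gen; case: Gy => [Qy|[f ltf ->]]; [left|right].
  exact: submod_Q.2.2.2.
by exists (vic_comp h f); rewrite ?act_comp //; apply: lt_h.
Qed.

(** At some [[R^n]], take an element of [N] not generated by [L] with the least bound [r]. This
    bound is not 0, as elements of [N] in [Q] are generated, so [below_split] gives a leading term;
    the last clause is the minimality of [r]. *)
Lemma minimal_remainder N L : is_submodule N ->
    (forall n (x : mobj M n), N n x -> exists r, below r x) ->
    (forall n (x : mobj M n), N n x -> Q x -> in_generated L x) ->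
    ~ (forall n (x : mobj M n), N n x -> in_generated L x) ->
  exists (u : {n : nat & VICHom R d n}) (x : mobj M (tag u)) (c : k),
    [/\ N _ x, ~ in_generated L x, below (vic_rank (tagged u)) (x - c *: act (tagged u) g)
      & forall y : mobj M (tag u), N _ y -> below (vic_rank (tagged u)) y ->
          in_generated L y].
Proof.
move=> sN N_below NQ notgen.
have [n /existsNP[x /not_implyP[Nx notx]]] := (existsNP _).2 notgen.
have [r0 r0x] := N_below _ _ Nx.
pose bad r := exists y : mobj M n, [/\ N n y, ~ in_generated L y & below r y].
have ex_bad : exists r, `[< bad r >] by exists r0; apply/asboolP; exists x.
case: (ex_minnP ex_bad) => r /asboolP[y [Ny noty ry]] min_r.
have min_lt r' z : (r' < r)%N -> N n z -> below r' z -> in_generated L z.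
  move=> ltr Nz rz; apply: contrapT => notz; move: ltr; rewrite ltnNge min_r //.
  by apply/asboolP; exists z.
case: r => [|r] in ry min_r min_lt *; first by case: noty; apply: NQ => //;
  apply: below0.
case: (below_split ry) => [ry'|[f rf [c ryc]]]; first by case: noty;
  apply: min_lt Ny ry'.
exists (existT _ n f), y, c; split=> //=; rewrite rf // => z; exact: min_lt.
Qed.

(* Otherwise pick remainders [x_i], outside the submodule generated by the
   previous ones, with leading monomials [u_i] of minimal rank.  Along a
   subsequence the [u_i] divide each other, and some leading coefficient is a
   combination of the previous ones; subtracting the corresponding translates
   gives a remainder of smaller rank. *)
Lemma groebner_step N L0 : left_noetherian k -> is_submodule N ->
    (forall n (x : mobj M n), N n x -> exists r, below r x) ->
    List.Forall (fun u => N (projT1 u) (projT2 u)) L0 ->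
    (forall n (x : mobj M n), N n x -> Q x -> in_generated L0 x) ->
  fg_submodule N.
Proof.
move=> noeth_k sN N_below NL0 NQ; apply: contrapT => notfg.
pose ok L := List.Forall (fun u => N (projT1 u) (projT2 u)) L /\
  (forall n (x : mobj M n), N n x -> Q x -> in_generated L x).
pose E := {u : {n : nat & VICHom R d n} & mobj M (tag u) * k}%type.
pose u (e : E) := tag e; pose x (e : E) : mobj M (tag (u e)) := (tagged e).1.
pose c (e : E) : k := (tagged e).2.
have /choice[F FP] L : exists e : E, ok L ->
    [/\ N _ (x e), ~ in_generated L (x e),
      below (vic_rank (tagged (u e))) (x e - c e *: act (tagged (u e)) g)
    & forall y : mobj M (tag (u e)), N _ y -> below (vic_rank (tagged (u e))) y ->
          in_generated L y].
  have [[NL LQ]|notok] := pselect (ok L); last first.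
    by exists (existT _ (existT _ d (vic_id R d)) (0, 0)) => /notok.
  have [|v [y [a P]]] := minimal_remainder sN N_below LQ.
    move=> genL; apply: notfg; exists L; split=> // n y; split; first exact: genL.
    exact.
  by exists (existT _ v (y, a)).
pose Ls := fix Ls i := if i is i'.+1 then
  existT (fun n => mobj M n : Type) _ (x (F (Ls i'))) :: Ls i' else L0.
have okL i : ok (Ls i).
  elim: i => [|i [NL LQ]]; first by split.
  have [Nx _ _ _] := FP _ (conj NL LQ); split; first by constructor.
  by move=> n y Ny Qy; apply: in_generated_cons; apply: LQ.
pose e i := F (Ls i).
have eP i := FP _ (okL i).
have genL i j : (i < j)%N -> in_generated (Ls j) (x (e i)).
  elim: j => // j IH; rewrite ltnS leq_eqVlt => /orP[/eqP->|/IH].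
    exact: in_generated_head.
  exact: in_generated_cons.
have [s s_incr asc] := vic_divides_ascending (fun i => u (e i)).
have [K [r rK]] := left_noetherian_combination (fun i => c (e (s i))) noeth_k.
set eK := e (s K); have [NxK notxK xK minK] := eP (s K).
have ex_h (l : 'I_K) : exists h : VICHom R (tag (u (e (s l)))) (tag (u eK)),
    vic_comp h (tagged (u (e (s l)))) = tagged (u eK) /\
    forall f : VICHom R d (tag (u (e (s l)))),
      (vic_rank f < vic_rank (tagged (u (e (s l)))))%N ->
      (vic_rank (vic_comp h f) < vic_rank (tagged (u eK)))%N.
  by have [h hu lt_h] := asc l K (ltn_ord l); exists h; split.
pose h l := sval (cid (ex_h l)); have hP l := svalP (cid (ex_h l)).
pose combi := \sum_(l < K) r l *: act (h l) (x (e (s l))).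
have subN P : is_submodule P -> (forall l : 'I_K, P _ (x (e (s l)))) -> P _ combi.
  move=> sP Px; apply: submodule_sum => // l; apply: (sP.2.2.1).
  by apply: (sP.2.2.2); apply: Px.
have gen_combi : in_generated (Ls (s K)) combi.
  apply: (subN (in_generated (Ls (s K)))) => [|l]; first exact: in_generated_submodule.
  by apply: genL; apply: s_incr.
apply: notxK; rewrite -/eK -[x eK](subrK combi).
apply: (in_generated_submodule _).2.1 gen_combi; apply: minK.
  by apply: submoduleB => //; apply: (subN N) => // l; have [] := eP (s l).
(* The leading terms cancel: [h l] carries the monomial of index [s l] to that of index [s K], and
   the leading coefficients satisfy [rK]. Only lower terms remain, and [h l] keeps them low. *)
have -> : x eK - combi = x eK - c eK *: act (tagged (u eK)) g -
    \sum_(l < K) r l *: act (h l) (x (e (s l)) - c (e (s l)) *: act (tagged (u (e (s l)))) g).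
  rewrite -addrA -opprD; congr (_ - _); rewrite [c eK]rK scaler_suml -big_split /=.
  apply: eq_bigr => l _; rewrite -scalerA -scalerDr; congr (_ *: _).
  by rewrite -(hP l).1 -act_comp -actZ -actD addrC subrK.
apply: spanB => //; apply: span_sum => l; apply: spanZ.
by have [_ _ xl _] := eP (s l); apply: below_act (hP l).2 xl.
Qed.
End Step.

(** Ranks at [[R^n]] are at most the number of pairs of matrices, so one bound serves all translates
    of [g]. *)
Lemma span_below d (g : mobj M d) L n (x : mobj M n) :
    in_generated (existT _ d g :: L) x ->
  below g (in_generated L) #|{: 'M[R]_(n, d) * 'M[R]_(d, n)}|.+1 x.
Proof.
pose N n (x : mobj M n) :=
  below g (in_generated L) #|{: 'M[R]_(n, d) * 'M[R]_(d, n)}|.+1 x.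
have rank_lt m (f : VICHom R d m) :
    (vic_rank f < #|{: 'M[R]_(m, d) * 'M[R]_(d, m)}|.+1)%N.
  by rewrite ltnS max_card.
have sL := in_generated_submodule L.
have sN : is_submodule N.
  apply: is_submodule_act => [m|m y z|m a y|m l f y].
  - exact: span0.
  - exact: spanD.
  - exact: spanZ.
  - by apply: below_act.
move=> /(_ N sN); apply; constructor.
  apply: span_gen; right; exists (vic_id R d) => //=.
  by rewrite /act mact_id.
apply/List.Forall_forall => u Lu; apply: span_gen; left => P sP /List.Forall_forall.
exact.
Qed.

(** Induction on the list of generators: the part of [P] generated by [L] is finitely generated by
    induction, and [groebner_step], with the submodule generated by [L] as [Q], handles one more
    generator [g]. *)
Theorem vic_noetherian : left_noetherian k -> fg_module M ->
  forall N, is_submodule N -> fg_submodule N.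
Proof.
move=> noeth_k [G genG] N sN.
suff fgG L P : is_submodule P -> (forall n (x : mobj M n), P n x -> in_generated L x) ->
    fg_submodule P by apply: (fgG G).
elim: L P => [|[d g] L IH] P sP PL.
  exists [::]; split=> // n x; split=> [|Lx]; first exact: PL.
  exact: Lx.
pose PQ n (x : mobj M n) := P n x /\ in_generated L x.
have sPQ : is_submodule PQ.
  have [L0 [LD [LZ Lact]]] := in_generated_submodule L; have [P0 [PD [PZ Pact]]] := sP.
  split; [|split; [|split]].
  - by move=> n; split.
  - by move=> n x y [? ?] [? ?]; split; [apply: PD | apply: LD].
  - by move=> n a x [? ?]; split; [apply: PZ | apply: LZ].
  - by move=> n m f pf x [? ?]; split; [apply: Pact | apply: Lact].
have [L0 [PL0 L0P]] : fg_submodule PQ by apply: IH => // n x [].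
apply: (@groebner_step d g (in_generated L) (in_generated_submodule L) P L0) => //.
- by move=> n x /PL /span_below; eexists; eassumption.
- by apply: List.Forall_impl PL0 => u [].
- by move=> n x Px Lx; apply/L0P.
Qed.
End Groebner.

Theorem theorem2p1 (R : finPzRingType) :
  exists S : VICSubcat R,
    (forall d n (f : VICHom R d n),
       exists (f1 : VICHom R d d) (f2 : VICHom R d n),
         sc_mem S f2 /\ f = vic_comp f2 f1) /\
    (forall k : pzRingType, left_noetherian k -> locally_noetherian S k).
Proof.
exists (vic_full R); split=> [d n f|k noeth_k M fgM].
  exists (vic_id R d), f; split=> //.
  by apply: VICHom_eq; rewrite /= ?mulmx1 ?mul1mx.
exact: vic_noetherian.
Qed.
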